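(* Let $(\mathcal{A}, G, \alpha)$ be a dynamical system. Let $\text{C*-Lat}(\mathcal{A},G,\alpha)$ denote the set of all equivalence classes of $\alpha$-admissible C*-covers for $\mathcal{A}$, partially ordered by $\preceq$. Then $\text{C*-Lat}(\mathcal{A},G,\alpha)$ forms a complete sublattice of the complete lattice $\text{C*-Lat}(\mathcal{A})$.
   Context: An (operator algebra) dynamical system $(\mathcal{A},G,\alpha)$ consists of an approximately unital (possibly non-self-adjoint) operator algebra $\mathcal{A}$, a locally compact Hausdorff group $G$, and a strongly continuous group representation $\alpha:G\to\mathrm{Aut}(\mathcal{A})$ such that each $\alpha_s$ is a completely isometric automorphism. A C*-cover for $\mathcal{A}$ is a pair $(\mathcal{C},j)$ where $\mathcal{C}$ is a C*-algebra and $j:\mathcal{A}\to\mathcal{C}$ is a completely isometric homomorphism with $\mathcal{C}=C^*(j(\mathcal{A}))$. It is $\alpha$-admissible if there is a (necessarily unique) strongly continuous action $\tilde\alpha:G\to\mathrm{Aut}(\mathcal{C})$ by $*$-automorphisms with $\tilde\alpha_s\circ j=j\circ\alpha_s$ for all $s\in G$. For C*-covers write $(\mathcal{C}_1,j_1)\preceq(\mathcal{C}_2,j_2)$ if there is a $*$-homomorphism $\pi:\mathcal{C}_2\to\mathcal{C}_1$ (necessarily surjective) with $\pi\circ j_2=j_1$; the two covers are equivalent if such a $\pi$ can be chosen to be a $*$-isomorphism. $\alpha$-admissibility depends only on the equivalence class. $\text{C*-Lat}(\mathcal{A})$ is the set of equivalence classes of C*-covers for $\mathcal{A}$, partially ordered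 by $\preceq$. It has a largest element $(C^*_{\max}(\mathcal{A}),i_{\max})$ (the maximal C*-cover) and a smallest element $C^*_e(\mathcal{A})$ (the C*-envelope). It is a complete lattice with the following operations. For a collection $\{(\mathcal{C}_\lambda,j_\lambda):\lambda\in\Lambda\}$ of C*-covers, the join $\bigvee_\lambda\mathcal{C}_\lambda$ is the class of $\big(C^*((\bigoplus_\lambda j_\lambda)(\mathcal{A})),\bigoplus_\lambda j_\lambda\big)$, with the C*-algebra taken inside $\bigoplus_\lambda\mathcal{C}_\lambda$. The meet $\bigwedge_\lambda\mathcal{C}_\lambda$ is the class of $(C^*_{\max}(\mathcal{A})/J,q_J\circ i_{\max})$, where $q_\lambda:C^*_{\max}(\mathcal{A})\to\mathcal{C}_\lambda$ is the $*$-epimorphism with $q_\lambda\circ i_{\max}=j_\lambda$, $J$ is the norm closure of $\sum_\lambda\ker q_\lambda$, and $q_J$ is the quotient map. These are the supremum and infimum with respect to $\preceq$. A complete sublattice is a subset closed under the joins and meets (taken in $\text{C*-Lat}(\mathcal{A})$) of arbitrary collections of its elements. *)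

(* Defs.v *)
From HB Require Import structures.
From mathcomp Require Import all_boot all_order all_algebra.
From mathcomp Require Import all_classical all_reals.
From mathcomp Require Import topology normedtype.
From mathcomp Require Import complex.
Set Implicit Arguments.
Unset Strict Implicit.
Unset Printing Implicit Defensive.
Import Order.TTheory GRing.Theory Num.Theory.
Import numFieldNormedType.Exports.
Local Open Scope classical_set_scope.
Local Open Scope complex_scope.
Local Open Scope ring_scope.

(* Scalars are R[i] for R : realType.  In a normedModType over R[i] the norm
   takes its values in R[i] (they are nonnegative, hence real). *)

(* The canonical numFieldType of R[i], named here because passing the bare type
   would leave a reverse_coercion node in every term. *)
Local Notation cplx R := (complex_complex__canonical__Num_NumField R).

#[short(type="preTopologicalGroupType")]
HB.structure Definition PreTopologicalGroup := {G of Topological G & Group G}.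

HB.mixin Record PreTopologicalGroup_isTopologicalGroup G
    of PreTopologicalGroup G := {
  mulg_continuous : continuous (fun x : G * G => (x.1 * x.2)%g);
  invg_continuous : continuous (fun x : G => x^-1%g)
}.

#[short(type="topologicalGroupType")]
HB.structure Definition TopologicalGroup :=
  {G of PreTopologicalGroup G & PreTopologicalGroup_isTopologicalGroup G}.

(* Banach and C*-algebras need not be unital, so their multiplication cannot be
   that of MathComp's rings. *)

HB.mixin Record CompleteNormedModule_isBanachAlgebra (R : realType) A
    of CompleteNormedModule (cplx R) A := {
  amul : A -> A -> A;
  amulA : associative amul;
  amulDl : left_distributive amul +%R;
  amulDr : right_distributive amul +%R;
  amulZl : forall (k : R[i]) (x y : A), amul (k *: x) y = k *: amul x y;
  amulZr : forall (k : R[i]) (x y : A), amul x (k *: y) = k *: amul x y;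
  normr_amul : forall x y : A, `|amul x y| <= `|x| * `|y|
}.

#[short(type="banachAlgType")]
HB.structure Definition BanachAlgebra (R : realType) :=
  {A of CompleteNormedModule (cplx R) A & CompleteNormedModule_isBanachAlgebra R A}.

HB.mixin Record BanachAlgebra_isCStarAlgebra (R : realType) A
    of BanachAlgebra R A := {
  star : A -> A;
  starK : involutive star;
  starD : {morph star : x y / x + y};
  starZ : forall (k : R[i]) (x : A), star (k *: x) = k^* *: star x;
  starM : forall x y : A, star (amul x y) = amul (star y) (star x);
  normr_star_mul : forall x : A, `|amul (star x) x| = `|x| ^+ 2
}.

#[short(type="cstarAlgType")]
HB.structure Definition CStarAlgebra (R : realType) :=
  {A of BanachAlgebra R A & BanachAlgebra_isCStarAlgebra R A}.

Definition alg_hom (R : realType) (A B : banachAlgType R) (f : A -> B) : Prop :=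
  linear f /\ {morph f : x y / amul x y}.

Definition star_hom (R : realType) (B C : cstarAlgType R) (f : B -> C) : Prop :=
  alg_hom f /\ {morph f : x / star x}.

(* The entries lie in a non-unital algebra, so the operations of matrix.v that
   need a ring of entries are written out. *)

Definition mxamul (R : realType) (B : banachAlgType R) (n : nat)
    (x y : 'M[B]_n) : 'M[B]_n :=
  \matrix_(i, j) \sum_(k < n) amul (x i k) (y k j).

Definition mxstar (R : realType) (B : cstarAlgType R) (n : nat)
    (x : 'M[B]_n) : 'M[B]_n :=
  \matrix_(i, j) star (x j i).

(* N is the C*-norm of M_n(B), that is, the *-algebra M_n(B) with the norm N is
   a C*-algebra.  There is exactly one such N. *)
Definition cstar_mxnorm (R : realType) (B : cstarAlgType R) (n : nat)
    (N : 'M[B]_n -> R[i]) : Prop :=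
  exists (M : cstarAlgType R) (phi : 'M[B]_n -> M),
    [/\ bijective phi,
        forall (k : R[i]) (x y : 'M[B]_n),
          phi (map_mx ( *:%R k) x + y) = k *: phi x + phi y,
        forall x y : 'M[B]_n, phi (mxamul x y) = amul (phi x) (phi y),
        forall x : 'M[B]_n, phi (mxstar x) = star (phi x)
      & forall x : 'M[B]_n, N x = `|phi x|].

(* f_n : M_n(A) -> M_n(B) is isometric for all n, where M_n(A) carries the
   norm NA n and M_n(B) its C*-norm. *)
Definition mx_isometric (R : realType) (A : banachAlgType R)
    (B : cstarAlgType R) (NA : forall n, 'M[A]_n -> R[i]) (f : A -> B) : Prop :=
  forall n, exists2 N : 'M[B]_n -> R[i],
    cstar_mxnorm N & forall a : 'M[A]_n, NA n a = N (map_mx f a).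

(* An operator algebra is an algebra with matrix norms that is, completely
   isometrically, a subalgebra of a C*-algebra.  The image is norm closed since
   A is complete. *)

HB.mixin Record BanachAlgebra_isOperatorAlgebra (R : realType) A
    of BanachAlgebra R A := {
  mxnorm : forall n, 'M[A]_n -> R[i];
  opalg_representable : exists (B : cstarAlgType R) (f : A -> B),
    [/\ alg_hom f, forall a : A, `|f a| = `|a| & mx_isometric mxnorm f]
}.

#[short(type="opAlgType")]
HB.structure Definition OperatorAlgebra (R : realType) :=
  {A of BanachAlgebra R A & BanachAlgebra_isOperatorAlgebra R A}.

(* Contractive two-sided approximate identity; the net is given by the filter
   of its tails. *)
Definition approximately_unital (R : realType) (A : banachAlgType R) : Prop :=
  exists2 F : set_system A, ProperFilter F &
    (\forall e \near F, `|e| <= 1) /\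
    forall a : A, (amul e a @[e --> F] --> a) /\ (amul a e @[e --> F] --> a).

(* The direct sum of a family of C*-algebras consists of the sections bounded
   in norm, with the supremum norm (the sum over an empty family is the
   zero algebra). *)

Lemma normr_star (R : realType) (C : cstarAlgType R) (x : C) : `|star x| = `|x|.
Proof.
suff le (y : C) : `|y| <= `|star y|.
  by apply/eqP; rewrite eq_le le andbT -{2}[x]starK le.
have [->|y0] := eqVneq y 0; first by rewrite normr0.
have := normr_amul (star y) y.
by rewrite normr_star_mul expr2 ler_pM2r// normr_gt0.
Qed.

Record cstar_dsum (R : realType) (L : Type) (B : L -> cstarAlgType R) := CStarDSum {
  dsum_val :> forall l, B l;
  dsum_bounded : exists M : R, forall l, `|dsum_val l| <= M%:C
}.

Section DirectSum.
Context (R : realType) (L : Type) (B : L -> cstarAlgType R).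
Local Notation T := (cstar_dsum B).
Implicit Types (f g h : T) (l : L).

Lemma dsumP f g : (forall l, f l = g l) -> f = g.
Proof.
case: f g => [f bf] [g bg] /= fg.
have {}fg : f = g by apply: functional_extensionality_dep.
by subst g; rewrite (Prop_irrelevance bf bg).
Qed.

HB.instance Definition _ := gen_eqMixin T.
HB.instance Definition _ := gen_choiceMixin T.

Lemma ReK_norm l (x : B l) : (complex.Re `|x|)%:C = `|x|.
Proof. by apply: RRe_real; apply: normr_real. Qed.

Lemma ReK_normc (k : R[i]) : (complex.Re `|k|)%:C = `|k|.
Proof. by apply: RRe_real; apply: normr_real. Qed.

Lemma dsum0_bounded : exists M : R, forall l, `|0 : B l| <= M%:C.
Proof. by exists 0 => l; rewrite normr0. Qed.

Lemma dsumD_bounded f g : exists M : R, forall l, `|f l + g l| <= M%:C.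
Proof.
have [M fM] := dsum_bounded f; have [N gN] := dsum_bounded g.
by exists (M + N) => l; rewrite rmorphD (le_trans (ler_normD _ _))// lerD.
Qed.

Lemma dsumN_bounded f : exists M : R, forall l, `|- f l| <= M%:C.
Proof. by have [M fM] := dsum_bounded f; exists M => l; rewrite normrN. Qed.

Lemma dsumZ_bounded (k : R[i]) f : exists M : R, forall l, `|k *: f l| <= M%:C.
Proof.
have [M fM] := dsum_bounded f; exists (complex.Re `|k| * M) => l.
rewrite normrZ rmorphM /= ReK_normc.
by apply: ler_wpM2l; [exact: normr_ge0|exact: fM].
Qed.

Lemma dsumM_bounded f g : exists M : R, forall l, `|amul (f l) (g l)| <= M%:C.
Proof.
have [M fM] := dsum_bounded f; have [N gN] := dsum_bounded g.
exists (M * N) => l; rewrite rmorphM; apply: le_trans (normr_amul _ _) _.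
by apply: ler_pM; [exact: normr_ge0|exact: normr_ge0|exact: fM|exact: gN].
Qed.

Lemma dsumS_bounded f : exists M : R, forall l, `|star (f l)| <= M%:C.
Proof. by have [M fM] := dsum_bounded f; exists M => l; rewrite normr_star. Qed.

Definition dsum0 : T := CStarDSum dsum0_bounded.
Definition dsumD f g : T := CStarDSum (dsumD_bounded f g).
Definition dsumN f : T := CStarDSum (dsumN_bounded f).
Definition dsumZ (k : R[i]) f : T := CStarDSum (dsumZ_bounded k f).
Definition dsumM f g : T := CStarDSum (dsumM_bounded f g).
Definition dsumS f : T := CStarDSum (dsumS_bounded f).

Let dsum_addA : associative dsumD.
Proof. by move=> f g h; apply: dsumP => l /=; rewrite addrA. Qed.
Let dsum_addC : commutative dsumD.
Proof. by move=> f g; apply: dsumP => l /=; rewrite addrC. Qed.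
Let dsum_add0 : left_id dsum0 dsumD.
Proof. by move=> f; apply: dsumP => l /=; rewrite add0r. Qed.
Let dsum_addN : left_inverse dsum0 dsumN dsumD.
Proof. by move=> f; apply: dsumP => l /=; rewrite addNr. Qed.

HB.instance Definition _ :=
  GRing.isZmodule.Build T dsum_addA dsum_addC dsum_add0 dsum_addN.

Let dsum_scaleA (a b : R[i]) f : dsumZ a (dsumZ b f) = dsumZ (a * b) f.
Proof. by apply: dsumP => l /=; rewrite scalerA. Qed.
Let dsum_scale1 : left_id 1 dsumZ.
Proof. by move=> f; apply: dsumP => l /=; rewrite scale1r. Qed.
Let dsum_scaleDr : right_distributive dsumZ +%R.
Proof. by move=> k f g; apply: dsumP => l /=; rewrite scalerDr. Qed.
Let dsum_scaleDl f : {morph dsumZ^~ f : a b / a + b}.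
Proof. by move=> a b; apply: dsumP => l /=; rewrite scalerDl. Qed.

HB.instance Definition _ := GRing.Zmodule_isLmodule.Build R[i] T
  dsum_scaleA dsum_scale1 dsum_scaleDr dsum_scaleDl.

Definition dsum_norm f : R := sup (range (fun l => complex.Re `|f l|)).

Lemma dsum_norm_ge f l : `|f l| <= (dsum_norm f)%:C.
Proof.
rewrite -ReK_norm lecR; apply: ub_le_sup; last by exists l.
have [M fM] := dsum_bounded f; exists M => _ [l' _ <-].
by rewrite -lecR ReK_norm.
Qed.

Lemma dsum_norm_le f (M : R) :
  0 <= M -> (forall l, `|f l| <= M%:C) -> dsum_norm f <= M.
Proof.
move=> M0 fM; rewrite /dsum_norm.
have [->|/set0P r0] := eqVneq (range (fun l => complex.Re `|f l|)) set0.
  by rewrite sup0.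
by apply: ge_sup => // _ [l _ <-]; rewrite -lecR ReK_norm.
Qed.

Lemma dsum_norm_ge0 f : 0 <= dsum_norm f.
Proof.
have [r0|/set0P[_ [l _ _]]] :=
  eqVneq (range (fun l => complex.Re `|f l|)) set0; first by rewrite /dsum_norm r0 sup0.
by rewrite -lecR; apply: le_trans (dsum_norm_ge f l); exact: normr_ge0.
Qed.

Definition dsum_normC f : R[i] := (dsum_norm f)%:C.

Lemma dsum_normC_le f (M : R[i]) :
  0 <= M -> (forall l, `|f l| <= M) -> dsum_normC f <= M.
Proof.
move=> M0; have <- : (complex.Re M)%:C = M by apply: RRe_real; exact: ger0_real.
move=> fM; rewrite lecR; apply: dsum_norm_le => //.
by rewrite -lecR RRe_real//; exact: ger0_real.
Qed.

Let dsum_normD f g : dsum_normC (f + g) <= dsum_normC f + dsum_normC g.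
Proof.
rewrite -rmorphD lecR; apply: dsum_norm_le => [|l].
  by rewrite addr_ge0// dsum_norm_ge0.
by rewrite rmorphD (le_trans (ler_normD _ _))// lerD// dsum_norm_ge.
Qed.

Let dsum_normZ (k : R[i]) f : dsum_normC (k *: f) = `|k| * dsum_normC f.
Proof.
have le (a : R[i]) g : dsum_normC (a *: g) <= `|a| * dsum_normC g.
  rewrite -[`|a|]ReK_normc -rmorphM lecR; apply: dsum_norm_le => [|l].
    apply: mulr_ge0 (dsum_norm_ge0 g); rewrite -lecR ReK_normc; exact: normr_ge0.
  rewrite /= normrZ rmorphM /= ReK_normc.
  by apply: ler_wpM2l; [exact: normr_ge0|exact: dsum_norm_ge].
apply/eqP; rewrite eq_le le /=.
have [->|k0] := eqVneq k 0; first by rewrite normr0 mul0r lecR dsum_norm_ge0.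
rewrite -[in leLHS](scale1r f) -(mulVf k0) -scalerA.
rewrite (le_trans (ler_wpM2l (normr_ge0 k) (le _ _)))//.
by rewrite mulrA -normrM mulfV// normr1 mul1r.
Qed.

Let dsum_norm0_eq0 f : dsum_normC f = 0 -> f = 0.
Proof.
move=> f0; apply: dsumP => l /=; apply/eqP; rewrite -normr_le0.
by rewrite (le_trans (dsum_norm_ge f l))//; rewrite /dsum_normC in f0; rewrite f0.
Qed.

HB.instance Definition _ := Lmodule_isNormed.Build (cplx R) T
  dsum_normD dsum_normZ dsum_norm0_eq0.

Lemma normr_dsumE f : `|f| = (dsum_norm f)%:C. Proof. by []. Qed.

Definition dsum_proj l f : B l := f l.

Let dsum_complete (F : set_system T) : ProperFilter F -> cauchy F -> cvg F.
Proof.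
move=> FF /cauchyP Fc.
have Fl l : cvg (dsum_proj l @ F).
  apply: cauchy_cvg; apply/cauchyP => e e0; have [f Ff] := Fc e e0.
  exists (f l).
  have : F [set h : T | ball (f l) e (h l)].
    apply: filterS Ff => h; rewrite -!ball_normE /=.
    exact: le_lt_trans (dsum_norm_ge (f - h) l).
  by [].
pose g l : B l := lim (dsum_proj l @ F).
have key (e : R[i]) (f : T) : 0 < e -> F (ball f e) -> forall l, `|f l - g l| <= e.
  move=> e0 Ff l; apply/ler_addgt0Pr => d d0.
  have Fg : dsum_proj l @ F --> g l by exact: Fl.
  have Fd : F [set h : T | `|g l - h l| < d] by move/cvgrPdist_lt : Fg => /(_ d d0).
  have [h []] := filter_ex (filterI Ff Fd).
  rewrite -ball_normE /= => fh gh; rewrite -(subrKA (h l)).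
  apply: le_trans (ler_normD _ _) _; apply: lerD; apply: ltW; last by rewrite distrC.
  exact: le_lt_trans (dsum_norm_ge (f - h) l) fh.
have g_bounded : exists M : R, forall l, `|g l| <= M%:C.
  have [f Ff] := Fc 1 ltr01; have [M fM] := dsum_bounded f.
  exists (1 + M) => l; rewrite -(subrK (f l) (g l)) rmorphD.
  by rewrite (le_trans (ler_normD _ _))// lerD// distrC key.
apply/cvg_ex; exists (CStarDSum g_bounded).
apply/cvgrPdist_lt => e e0.
have e20 : 0 < e / 2%:R by rewrite divr_gt0.
have e40 : 0 < e / 2%:R / 2%:R by rewrite divr_gt0.
have [f Ff] := Fc _ e40.
apply: filterS (Ff) => h; rewrite -ball_normE /= => fh.
rewrite -(subrKA f); apply: le_lt_trans (ler_normD _ _) _.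
have gf : `|CStarDSum g_bounded - f| <= e / 2%:R / 2%:R.
  apply: dsum_normC_le; first exact: ltW.
  by move=> l; rewrite /= distrC; exact: key.
apply: (le_lt_trans (lerD gf (ltW fh))).
by rewrite -splitr ltr_pdivrMr ?ltr0n// ltr_pMr// ltr1n.
Qed.

HB.instance Definition _ := Uniform_isComplete.Build T dsum_complete.

Let dsum_mulA : associative dsumM.
Proof. by move=> f g h; apply: dsumP => l /=; rewrite amulA. Qed.
Let dsum_mulDl : left_distributive dsumM +%R.
Proof. by move=> f g h; apply: dsumP => l /=; rewrite amulDl. Qed.
Let dsum_mulDr : right_distributive dsumM +%R.
Proof. by move=> f g h; apply: dsumP => l /=; rewrite amulDr. Qed.
Let dsum_mulZl (k : R[i]) f g : dsumM (k *: f) g = k *: dsumM f g.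
Proof. by apply: dsumP => l /=; rewrite amulZl. Qed.
Let dsum_mulZr (k : R[i]) f g : dsumM f (k *: g) = k *: dsumM f g.
Proof. by apply: dsumP => l /=; rewrite amulZr. Qed.
Let dsum_normM f g : `|dsumM f g| <= `|f| * `|g|.
Proof.
rewrite !normr_dsumE -rmorphM lecR; apply: dsum_norm_le => [|l].
  by rewrite mulr_ge0// dsum_norm_ge0.
by rewrite rmorphM (le_trans (normr_amul _ _))// ler_pM// dsum_norm_ge.
Qed.

HB.instance Definition _ := CompleteNormedModule_isBanachAlgebra.Build R T
  dsum_mulA dsum_mulDl dsum_mulDr dsum_mulZl dsum_mulZr dsum_normM.

Let dsum_starK : involutive dsumS.
Proof. by move=> f; apply: dsumP => l /=; rewrite starK. Qed.
Let dsum_starD : {morph dsumS : f g / f + g}.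
Proof. by move=> f g; apply: dsumP => l /=; rewrite starD. Qed.
Let dsum_starZ (k : R[i]) f : dsumS (k *: f) = k^* *: dsumS f.
Proof. by apply: dsumP => l /=; rewrite starZ. Qed.
Let dsum_starM f g : dsumS (amul f g) = amul (dsumS g) (dsumS f).
Proof. by apply: dsumP => l /=; rewrite starM. Qed.
Let dsum_norm_star f : `|amul (dsumS f) f| = `|f| ^+ 2.
Proof.
apply/eqP; rewrite eq_le; apply/andP; split.
  rewrite (le_trans (normr_amul _ _))// expr2 ler_wpM2r//.
  rewrite !normr_dsumE lecR; apply: dsum_norm_le => [|l].
    exact: dsum_norm_ge0.
  by rewrite /= normr_star dsum_norm_ge.
set h := amul _ f; rewrite !normr_dsumE -rmorphXn lecR.
have N0 := dsum_norm_ge0 h.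
rewrite -(sqr_sqrtr N0) ler_sqr ?nnegrE ?sqrtr_ge0 ?dsum_norm_ge0//.
apply: dsum_norm_le => [|l]; first exact: sqrtr_ge0.
rewrite -ReK_norm lecR -ler_sqr ?nnegrE ?sqrtr_ge0//; last first.
  by rewrite -lecR ReK_norm; exact: normr_ge0.
rewrite sqr_sqrtr// -lecR rmorphXn /= ReK_norm -normr_star_mul.
exact: (dsum_norm_ge h l).
Qed.

HB.instance Definition _ := BanachAlgebra_isCStarAlgebra.Build R T
  dsum_starK dsum_starD dsum_starZ dsum_starM dsum_norm_star.

End DirectSum.

Definition group_action (G : groupType) (T : Type) (act : G -> T -> T) : Prop :=
  (forall x, act 1%g x = x) /\
  forall s t x, act (s * t)%g x = act s (act t x).

Definition strongly_continuous (G T : topologicalType) (act : G -> T -> T) : Prop :=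
  forall x, continuous (fun s => act s x).

Definition dynamical_system (R : realType) (A : opAlgType R)
    (G : topologicalGroupType) (alpha : G -> A -> A) : Prop :=
  [/\ approximately_unital A,
      hausdorff_space G /\ locally_compact [set: G],
      group_action alpha,
      forall s, alg_hom (alpha s) /\
        forall n (a : 'M[A]_n), mxnorm n (map_mx (alpha s) a) = mxnorm n a
    & strongly_continuous alpha].

Definition star_subalgebra (R : realType) (B : cstarAlgType R) (S : set B) : Prop :=
  [/\ S 0,
      forall (k : R[i]) x y, S x -> S y -> S (k *: x + y),
      forall x y, S x -> S y -> S (amul x y)
    & forall x, S x -> S (star x)].

Definition cstar_gen (R : realType) (B : cstarAlgType R) (X : set B) : set B :=
  smallest [set S | star_subalgebra S /\ closed S] X.

Record cstar_cover (R : realType) (A : opAlgType R) := CStarCover {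
  cover_alg :> cstarAlgType R;
  cover_map : A -> cover_alg;
  cover_map_hom : alg_hom cover_map;
  cover_map_isometric : mx_isometric (@mxnorm R A) cover_map;
  cover_gen : cstar_gen (range cover_map) = [set: cover_alg]
}.

Definition admissible (R : realType) (A : opAlgType R)
    (G : topologicalGroupType) (alpha : G -> A -> A) (c : cstar_cover A) : Prop :=
  exists beta : G -> c -> c,
    [/\ group_action beta,
        forall s, star_hom (beta s),
        strongly_continuous beta
      & forall s a, beta s (cover_map c a) = cover_map c (alpha s a)].

Definition cover_le (R : realType) (A : opAlgType R) (c1 c2 : cstar_cover A) : Prop :=
  exists2 p : c2 -> c1,
    star_hom p & forall a, p (cover_map c2 a) = cover_map c1 a.

Definition cover_equiv (R : realType) (A : opAlgType R) (c1 c2 : cstar_cover A) : Prop :=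
  exists2 p : c2 -> c1,
    star_hom p /\ bijective p & forall a, p (cover_map c2 a) = cover_map c1 a.

Definition is_maximal_cover (R : realType) (A : opAlgType R) (m : cstar_cover A) : Prop :=
  forall c, cover_le c m.

Definition is_cstar_envelope (R : realType) (A : opAlgType R) (e : cstar_cover A) : Prop :=
  forall c, cover_le e c.

(* d represents the class of (C*((+)_l j_l (A)), (+)_l j_l), the C*-algebra being
   generated inside the direct sum; J is the map (+)_l j_l.  For the empty family
   that pair is not a cover (unless A = 0), and the join in the complete lattice
   is the least element. *)
Definition is_cover_join (R : realType) (A : opAlgType R) (L : Type)
    (c : L -> cstar_cover A) (d : cstar_cover A) : Prop :=
  (inhabited L ->
    exists (J : A -> cstar_dsum c) (phi : d -> cstar_dsum c),
      [/\ forall a l, J a l = cover_map (c l) a,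
          star_hom phi,
          injective phi,
          range phi = cstar_gen (range J)
        & forall a, phi (cover_map d a) = J a]) /\
  (~ inhabited L -> is_cstar_envelope d).

Definition sum_ker (R : realType) (L : Type) (M : cstarAlgType R)
    (B : L -> cstarAlgType R) (q : forall l, M -> B l) : set M :=
  [set x | exists n (l : 'I_n -> L) (y : 'I_n -> M),
     (forall i, q (l i) (y i) = 0) /\ x = \sum_(i < n) y i].

(* d represents the class of (C*_max(A)/J, q_J o i_max) with J the closure of the
   sum of the ker q_l: phi induces a *-isomorphism of C*_max(A)/J onto d. *)
Definition is_cover_meet (R : realType) (A : opAlgType R) (L : Type)
    (c : L -> cstar_cover A) (d : cstar_cover A) : Prop :=
  exists (m : cstar_cover A) (q : forall l, m -> c l) (phi : m -> d),
    [/\ is_maximal_cover m,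
        forall l, star_hom (q l) /\
          forall a, q l (cover_map m a) = cover_map (c l) a,
        star_hom phi /\ (forall a, phi (cover_map m a) = cover_map d a),
        range phi = [set: d]
      & phi @^-1` [set 0] = closure (sum_ker q)].

Section Lattice.
Context (R : realType) (A : opAlgType R).

(* Plain predicates: the universe of set lies below that of cstar_cover. *)
Definition cover_pred := cstar_cover A -> Prop.

Definition cover_class (c : cstar_cover A) : cover_pred := cover_equiv c.

Definition CLat (x : cover_pred) : Prop := exists c, x = cover_class c.

Definition CLat_admissible (G : topologicalGroupType) (alpha : G -> A -> A)
    (x : cover_pred) : Prop :=
  exists2 c, admissible alpha c & x = cover_class c.

Definition CLat_join (L : Type) (x : L -> cover_pred) (y : cover_pred) : Prop :=
  exists (c : L -> cstar_cover A) (d : cstar_cover A),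
    [/\ forall l, x l = cover_class (c l), y = cover_class d & is_cover_join c d].

Definition CLat_meet (L : Type) (x : L -> cover_pred) (y : cover_pred) : Prop :=
  exists (c : L -> cstar_cover A) (d : cstar_cover A),
    [/\ forall l, x l = cover_class (c l), y = cover_class d & is_cover_meet c d].

Definition complete_sublattice (S : cover_pred -> Prop) : Prop :=
  (forall x, S x -> CLat x) /\
  forall (L : Type) (x : L -> cover_pred), (forall l, S (x l)) ->
    (forall y, CLat_join x y -> S y) /\ (forall y, CLat_meet x y -> S y).

End Lattice.

(* Main.v *)
(* A C*-cover is [alpha]-admissible as soon as every [alpha s] extends to a
   *-endomorphism of it: *-homomorphisms are contractive, so the group law and
   strong continuity propagate from the generators to the whole C*-algebra.
   Such extensions pass to the join by acting coordinatewise on the direct sum.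
   For the meet, the maximal cover extends every [alpha s], since it dominates
   its own twist by [alpha s]; the extension preserves each kernel [ker q_l],
   hence [J], and descends to the quotient.

   Contractivity is obtained without spectral theory: if [h] is self-adjoint with
   [|h| < 1], a fixed-point argument gives a self-adjoint [w] commuting with [h]
   such that [h^2 + (1 - w)^2 = 1], so the image of [h] is the real part of a
   unitary. *)

Require Import Defs.
From mathcomp Require Import all_boot all_algebra all_reals.
From mathcomp Require Import all_order all_classical topology normedtype sequences.
From mathcomp Require Import complex.
Set Implicit Arguments.
Unset Strict Implicit.
Unset Printing Implicit Defensive.
Import Order.TTheory GRing.Theory Num.Theory.
Import numFieldNormedType.Exports.
Local Open Scope classical_set_scope.
Local Open Scope complex_scope.
Local Open Scope ring_scope.

(** * Limits in Banach algebras *)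

Lemma ex_expn_lt (R : realType) (r e : R[i]) :
  0 <= r < 1 -> 0 < e -> exists n, r ^+ n < e.
Proof.
move=> /andP[r0 r1] e0.
have rE : r = (complex.Re r)%:C by rewrite RRe_real// ger0_real.
have eE : e = (complex.Re e)%:C by rewrite RRe_real// gtr0_real.
move: r0 r1 e0; rewrite rE eE lecR !ltcR => r0 r1 e0.
have /cvgrPdist_lt/(_ _ e0)[n _ rn] :
    (GRing.exp (complex.Re r) : R^nat) @ \oo --> (0 : R).
  by apply: cvg_expr; rewrite ger0_norm.
exists n; rewrite -rmorphXn ltcR.
by have := rn n (leqnn n); rewrite sub0r normrN ger0_norm// exprn_ge0.
Qed.

Section BanachAlgebraTheory.
Context (R : realType) (B : banachAlgType R).
Implicit Types x y z : B.

Lemma amul0r x : amul 0 x = 0.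
Proof. by apply: (addIr (amul 0 x)); rewrite -amulDl !add0r. Qed.

Lemma amulr0 x : amul x 0 = 0.
Proof. by apply: (addIr (amul x 0)); rewrite -amulDr !add0r. Qed.

Lemma amulNr x y : amul (- x) y = - amul x y.
Proof. by apply: (addIr (amul x y)); rewrite -amulDl !addNr amul0r. Qed.

Lemma amulrN x y : amul x (- y) = - amul x y.
Proof. by apply: (addIr (amul x y)); rewrite -amulDr !addNr amulr0. Qed.

Lemma amulBl x y z : amul (x - y) z = amul x z - amul y z.
Proof. by rewrite amulDl amulNr. Qed.

Lemma amulBr x y z : amul x (y - z) = amul x y - amul x z.
Proof. by rewrite amulDr amulrN. Qed.

Lemma cvg_amul (T : Type) (F : set_system T) {FF : Filter F} (f g : T -> B) x y :
  f @ F --> x -> g @ F --> y -> (fun t => amul (f t) (g t)) @ F --> amul x y.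
Proof.
move=> fx gy; apply/cvgrPdist_le => e e0.
(* Sized so that the three terms of the expansion below, bounded by [|x| * d], [d * |y|] and
   [1 * d], add up to [e]. *)
pose d := e / (1 + `|x| + `|y|).
have s0 : 0 < 1 + `|x| + `|y| by rewrite -addrA ltr_wpDr// addr_ge0.
have d0 : 0 < d by rewrite divr_gt0.
near=> t.
have f1 : `|x - f t| <= 1 by near: t; move/cvgrPdist_le: fx; apply.
have fd : `|x - f t| <= d by near: t; move/cvgrPdist_le: fx; apply.
have gd : `|y - g t| <= d by near: t; move/cvgrPdist_le: gy; apply.
have -> : amul x y - amul (f t) (g t) =
    amul x (y - g t) + amul (x - f t) y - amul (x - f t) (y - g t).
  rewrite !amulBl !amulBr.
  set a := amul x y; set b := amul x (g t); set c := amul (f t) y.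
  rewrite opprB -[in RHS]addrA (addrA (a - c)) subrKA.
  by rewrite [RHS]addrC subrK.
have -> : e = `|x| * d + d * `|y| + 1 * d.
  by rewrite [d * _]mulrC -!mulrDl [_ + 1]addrC addrA mulrC divfK// gt_eqF.
apply: le_trans (ler_normB _ _) _; apply: lerD; last first.
  by rewrite (le_trans (normr_amul _ _))// ler_pM.
apply: le_trans (ler_normD _ _) _; apply: lerD.
  by rewrite (le_trans (normr_amul _ _))// ler_wpM2l.
by rewrite (le_trans (normr_amul _ _))// ler_wpM2r.
Unshelve. all: by end_near. Qed.

Lemma closure_normP (S : set B) x :
  closure S x <-> forall e : R[i], 0 < e -> exists2 y, S y & `|x - y| < e.
Proof.
split=> [Sx e e0|Sx U].
  have [|y [Sy]] := Sx (ball x e); first exact: nbhsx_ballx.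
  by rewrite -ball_normE; exists y.
move=> /nbhs_ballP[e /= e0 xU]; have [y Sy xy] := Sx e e0.
by exists y; split=> //; apply: xU; rewrite -ball_normE.
Qed.

Lemma closed_normP (S : set B) :
  (forall x, (forall e : R[i], 0 < e -> exists2 y, S y & `|x - y| < e) -> S x) ->
  closed S.
Proof. by move=> clS x /closure_normP; exact: clS. Qed.

End BanachAlgebraTheory.

(** * Star operation and a quadratic fixed point *)

Section CStarAlgebraTheory.
Context (R : realType) (B : cstarAlgType R).
Implicit Types x y z h : B.

Lemma star0 : star (0 : B) = 0.
Proof. by apply: (addIr (star 0)); rewrite -starD !add0r. Qed.

Lemma starN x : star (- x) = - star x.
Proof. by apply: (addIr (star x)); rewrite -starD !addNr star0. Qed.

Lemma starB x y : star (x - y) = star x - star y.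
Proof. by rewrite starD starN. Qed.

Lemma starZ_real (r : R) x : star (r%:C *: x) = r%:C *: star x.
Proof. by rewrite starZ; congr (_ *: _); exact: conjc_real. Qed.

Lemma cvg_star (T : Type) (F : set_system T) {FF : Filter F} (f : T -> B) x :
  f @ F --> x -> (fun t => star (f t)) @ F --> star x.
Proof.
move=> fx; apply/cvgrPdist_le => e e0; move/cvgrPdist_le : fx => /(_ e e0).
by apply: filterS => t; rewrite -starB normr_star.
Qed.

Lemma star_half x : star (2^-1 *: x) = 2^-1 *: star x.
Proof. by rewrite starZ; congr (_ *: _); rewrite fmorphV rmorph_nat. Qed.

(** The [w] constructed is 1 - sqrt(1 - h^2) in the unitization; the equation is expanded so as not
    to mention the unit. It is the fixed point of [F], which maps the ball of radius [|h|] into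
    itself and is [|h|]-Lipschitz there. Self-adjointness and commutation hold for every iterate and
    pass to the limit. *)
Lemma half_root h : star h = h -> `|h| < 1 ->
  exists w, [/\ star w = w, amul w h = amul h w
    & w + w = amul h h + amul w w].
Proof.
move=> hs h1.
pose F x := 2^-1 *: (amul h h + amul x x).
pose w n := iter n F 0.
have half0 : 0 < 2^-1 :> R[i] by rewrite invr_gt0.
have ws n : star (w n) = w n.
  by elim: n => [|n IH]; rewrite /= ?star0// star_half starD !starM hs IH.
have wh n : amul (w n) h = amul h (w n).
  elim: n => [|n IH]; first by rewrite amul0r amulr0.
  rewrite /= amulZl amulZr amulDl amulDr -!amulA.
  by rewrite [amul h (amul h h)]amulA -!amulA IH [amul (w n) _]amulA IH -!amulA.
have wle n : `|w n| <= `|h|.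
  elim: n => [|n IH]; first by rewrite normr0.
  rewrite /= normrZ gtr0_norm// mulrC ler_pdivrMr// mulr_natr.
  have hh x : `|x| <= `|h| -> `|amul x x| <= `|h|.
    move=> xh; rewrite (le_trans (normr_amul _ _))//.
    by rewrite (le_trans (ler_pM _ _ xh (le_trans xh (ltW h1))))// mulr1.
  by rewrite (le_trans (ler_normD _ _))// mulr2n lerD// hh.
have Fctr x y : `|x| <= `|h| -> `|y| <= `|h| -> `|F x - F y| <= `|h| * `|x - y|.
  move=> xh yh; rewrite -scalerBr normrZ gtr0_norm// mulrC ler_pdivrMr//.
  have -> : amul h h + amul x x - (amul h h + amul y y) =
      amul (x - y) x + amul y (x - y).
    by rewrite opprD addrACA subrr add0r amulBl amulBr addrA subrK.
  rewrite mulr_natr mulr2n (le_trans (ler_normD _ _))// lerD//.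
    by rewrite (le_trans (normr_amul _ _))// mulrC ler_wpM2r.
  by rewrite (le_trans (normr_amul _ _))// ler_wpM2r.
(* Both iterates arise by applying [F] [n] times, to [0] and to [w m], which are at distance at most
   1. *)
have wC n m : `|w n - w (n + m)| <= `|h| ^+ n.
  elim: n => [|n IH]; first by rewrite sub0r normrN expr0 (le_trans (wle _) (ltW h1)).
  rewrite exprS (le_trans (Fctr _ _ (wle n) (wle (n + m)%N)))//.
  by rewrite ler_wpM2l.
have /cvg_ex[l wl] : cvg (w @ \oo).
  apply: cauchy_cvg; apply/cauchyP => e e0.
  have [|n hn] := @ex_expn_lt R `|h| e _ e0; first by rewrite normr_ge0.
  exists (w n); exists n => // m /= nm.
  by rewrite -ball_normE /= -(subnKC nm) (le_lt_trans (wC _ _)).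
have uniq (f g : nat -> B) (u v : B) :
    f =1 g -> f @ \oo --> u -> g @ \oo --> v -> u = v.
  by move=> /funext-> fu gv; exact: norm_cvg_unique fu gv.
exists l; split.
- exact: uniq ws (cvg_star wl) wl.
- by apply: (uniq _ _ _ _ wh); apply: cvg_amul => //; exact: cvg_cst.
have Fl : (fun n => F (w n)) @ \oo --> F l.
  by apply: cvgZl_tmp; apply: cvgD; [exact: cvg_cst|exact: cvg_amul].
have -> : l + l = 2 *: F l.
  rewrite scaler_nat mulr2n; congr (_ + _);
    by apply: (uniq (fun n => w n.+1) _ _ _ _ _ Fl) => //; rewrite (cvg_shiftS w).
by rewrite scalerA mulfV ?pnatr_eq0// scale1r.
Qed.
End CStarAlgebraTheory.

(** * Contractivity of *-homomorphisms *)

Section StarHomTheory.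
Context (R : realType) (B C : cstarAlgType R) (f : B -> C) (hf : star_hom f).

Lemma star_homM x y : f (amul x y) = amul (f x) (f y).
Proof. by case: hf => -[_ h] _; apply: h. Qed.

Lemma star_hom_star x : f (star x) = star (f x).
Proof. by case: hf => _; apply. Qed.

Lemma star_hom_lin (k : R[i]) x y : f (k *: x + y) = k *: f x + f y.
Proof. by case: hf => -[h _] _; apply: h. Qed.

Lemma star_homD x y : f (x + y) = f x + f y.
Proof. by have := star_hom_lin 1 x y; rewrite !scale1r. Qed.

Lemma star_hom0 : f 0 = 0.
Proof. by apply: (addIr (f 0)); rewrite -star_homD !add0r. Qed.

Lemma star_homZ (k : R[i]) x : f (k *: x) = k *: f x.
Proof. by have := star_hom_lin k x 0; rewrite star_hom0 !addr0. Qed.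

Lemma star_homB x y : f (x - y) = f x - f y.
Proof. by rewrite -scaleN1r star_homD star_homZ scaleN1r. Qed.

(* With [k], [v] the images of [h], [w] given by [half_root], the multipliers
   [k + c (1 - v)] for [c = i] and [c = - i] are unitary and their half-sum is
   [k].  As [C] need not have a unit, they act on [x] instead. *)
Lemma star_hom_selfadjoint_le1 h : star h = h -> `|h| < 1 -> `|f h| <= 1.
Proof.
move=> hs h1; have [w [ws wh ww]] := half_root hs h1.
set k := f h; set v := f w.
have ks : star k = k by rewrite -star_hom_star hs.
have vs : star v = v by rewrite -star_hom_star ws.
have vk : amul v k = amul k v by rewrite -!star_homM wh.
have vv : amul k k + amul v v = v + v by rewrite -!star_homM -!star_homD ww.
(* By the C*-identity it is enough to compare the elements [y^* y]. The cross terms cancel because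
   [c^* = - c] and [k] commutes with [v]; what remains is x^* (k^2 + (1 - v)^2) x = x^* x. *)
have isometric (c : R[i]) x : c^* = - c -> c * c = -1 ->
    `|amul k x + c *: (x - amul v x)| = `|x|.
  move=> cs cc; apply/eqP; rewrite -(@eqrXn2 _ 2)//; apply/eqP.
  rewrite -!normr_star_mul; congr `|_|.
  set p := amul k x; set q := x - amul v x.
  have sp : star p = amul (star x) k by rewrite starM ks.
  have sq : star q = star x - amul (star x) v by rewrite starB starM vs.
  have pq : amul (star p) q = amul (star q) p.
    rewrite sp sq amulBr amulBl /p -!amulA; congr (_ - _).
    by rewrite !amulA -[amul (amul _ k) v]amulA -vk amulA.
  rewrite starD starZ cs amulDl !amulDr !amulZl !amulZr pq !scaleNr addrA addrK.
  have -> : - (c *: (c *: amul (star q) q)) = amul (star q) q.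
    by rewrite scalerA cc scaleN1r opprK.
  have kkx : amul k (amul k x) = amul v x + amul v x - amul v (amul v x).
    by apply: (addIr (amul v (amul v x))); rewrite subrK !amulA -!amulDl vv.
  rewrite sp sq -amulA kkx amulBl -amulA -amulBr -amulDr; congr amul.
  by rewrite amulBr -[x - _ - _]addrA -opprD [amul v x + (_ - _)]addrA addrCA subrr addr0.
have kx x : `|amul k x| <= `|x|.
  pose d := 'i *: (x - amul v x).
  have kE : amul k x *+ 2 =
      (amul k x + d) + (amul k x + (- 'i) *: (x - amul v x)).
    by rewrite scaleNr addrACA subrr addr0.
  rewrite -(ler_pMn2r (ltn0Sn 1)) -normrMn kE (le_trans (ler_normD _ _))//.
  rewrite !isometric// ?mulrNN -?expr2 ?sqrCi//.
  - by rewrite rmorphN; congr (- _); exact: conjCi.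
  - exact: conjCi.
(* Since [k] is self-adjoint, [kx] at [x = k] reads |k|^2 <= |k|. *)
have [k0|k0] := eqVneq k 0; first by rewrite k0 normr0.
by have := kx k; rewrite -{1}ks normr_star_mul expr2 ger_pMl// normr_gt0.
Qed.

Lemma star_hom_selfadjoint_contractive h : star h = h -> `|f h| <= `|h|.
Proof.
move=> hs; apply/ler_addgt0Pr => e e0.
(* Dividing [h] by [|h| + e] brings it strictly inside the unit ball. The divisor is taken in [R] so
   that the scaling commutes with [star]. *)
pose r := complex.Re (`|h| + e).
have rE : r^-1%:C = (`|h| + e)^-1.
  by rewrite (fmorphV (real_complex R)) /= RRe_real// ger0_real// addr_ge0// ltW.
have r0 : 0 < `|h| + e by rewrite ltr_wpDl.
have := @star_hom_selfadjoint_le1 (r^-1%:C *: h).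
rewrite starZ_real hs star_homZ !normrZ rE gtr0_norm ?invr_gt0//.
rewrite !(mulrC _^-1) !ler_pdivrMr// ltr_pdivrMr// !mul1r; apply=> //.
by rewrite ltrDl.
Qed.

(** The C*-identity reduces the bound to the self-adjoint element [x^* x]. *)
Lemma star_hom_contractive x : `|f x| <= `|x|.
Proof.
rewrite -ler_sqr ?nnegrE// -!normr_star_mul -star_hom_star -star_homM.
by apply: star_hom_selfadjoint_contractive; rewrite starM starK.
Qed.

Lemma cvg_star_hom (T : Type) (F : set_system T) {FF : Filter F} (g : T -> B) x :
  g @ F --> x -> (fun t => f (g t)) @ F --> f x.
Proof.
move=> gx; apply/cvgrPdist_le => e e0; move/cvgrPdist_le : gx => /(_ e e0).
apply: filterS => t; rewrite -star_homB; apply: le_trans.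
exact: star_hom_contractive.
Qed.

Lemma star_hom_continuous : continuous f.
Proof. by move=> x; apply: (@cvg_star_hom _ (nbhs x) _ id); exact: cvg_id. Qed.

End StarHomTheory.

(** * Construction and uniqueness of *-homomorphisms *)

Section StarHomConstructions.
Context (R : realType).
Implicit Types B C D : cstarAlgType R.

Lemma star_hom_id B : star_hom (@id B).
Proof. by []. Qed.

Lemma star_hom_comp B C D (f : B -> C) (g : C -> D) :
  star_hom f -> star_hom g -> star_hom (g \o f).
Proof.
move=> [[fl fM] fs] [[gl gM] gs]; split; first split.
- by move=> k x y /=; rewrite fl gl.
- by move=> x y /=; rewrite fM gM.
- by move=> x /=; rewrite fs gs.
Qed.

(** Preimages are chosen pointwise; injectivity of [f] reflects every algebraic identity from [C]
    back to [D]. *)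
Lemma star_hom_lift B C D (f : D -> C) (g : B -> C) :
  star_hom f -> injective f -> star_hom g -> range g `<=` range f ->
  exists2 p : B -> D, star_hom p & forall x, f (p x) = g x.
Proof.
move=> hf fI hg gf.
have /choice[p fp] x : exists y, f y = g x.
  by have [|y _ yx] := gf (g x); [exists x|exists y].
exists p => //; split; first split.
- by move=> k x y; apply: fI; rewrite (star_hom_lin hf) !fp (star_hom_lin hg).
- by move=> x y; apply: fI; rewrite (star_homM hf) !fp (star_homM hg).
- by move=> x; apply: fI; rewrite (star_hom_star hf) !fp (star_hom_star hg).
Qed.

(** This replaces the universal property of the quotient by the kernel of [f]: the kernel inclusion
    makes [g] independent of the preimage picked by the section [r]. *)
Lemma star_hom_factor B C D (f : B -> C) (g : B -> D) :
  star_hom f -> range f = setT -> star_hom g ->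
  (forall x, f x = 0 -> g x = 0) ->
  exists2 p : C -> D, star_hom p & forall x, p (f x) = g x.
Proof.
move=> hf fT hg fg.
have /choice[r fr] y : exists x, f x = y.
  by have : range f y by [rewrite fT]; move=> [x _ <-]; exists x.
have gf x y : f x = f y -> g x = g y.
  move=> fxy; apply/subr0_eq; rewrite -star_homB//; apply: fg.
  by rewrite star_homB// fxy subrr.
exists (g \o r) => [|x]; last by apply: gf; rewrite fr.
split; first split.
- by move=> k x y /=; rewrite -(star_hom_lin hg); apply: gf;
  rewrite (star_hom_lin hf) !fr.
- by move=> x y /=; rewrite -(star_homM hg); apply: gf;
  rewrite (star_homM hf) !fr.
- by move=> x /=; rewrite -(star_hom_star hg); apply: gf;
  rewrite (star_hom_star hf) !fr.
Qed.

(** By continuity, the preimage of a closed *-subalgebra is again one. *)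
Lemma star_hom_cstar_gen B C (f : B -> C) (X : set B) (Y : set C) :
  star_hom f -> (forall x, X x -> Y (f x)) ->
  forall x, cstar_gen X x -> cstar_gen Y (f x).
Proof.
move=> hf XY x Xx S [[[S0 SZ SM Ss] Scl] YS]; apply: (Xx (f @^-1` S)).
split; last by move=> z /XY; exact: YS.
split; last first.
  by apply: preimage_closed Scl => z _; exact: star_hom_continuous.
split=> /=.
- by rewrite (star_hom0 hf).
- by move=> k y z Sy Sz; rewrite (star_hom_lin hf); exact: SZ.
- by move=> y z Sy Sz; rewrite (star_homM hf); exact: SM.
- by move=> y Sy; rewrite (star_hom_star hf); exact: Ss.
Qed.

(** The equalizer of [f] and [g] is a *-subalgebra, closed by contractivity. *)
Lemma star_hom_eq_gen B C (f g : B -> C) (X : set B) :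
  star_hom f -> star_hom g -> cstar_gen X = setT ->
  (forall x, X x -> f x = g x) -> f =1 g.
Proof.
move=> hf hg XT fg x.
have Xx : cstar_gen X x by rewrite XT.
apply: (Xx [set y | f y = g y]); split; last exact: fg.
split; first split=> /=.
- by rewrite (star_hom0 hf) (star_hom0 hg).
- by move=> k y z fy fz; rewrite (star_hom_lin hf) (star_hom_lin hg) fy fz.
- by move=> y z fy fz; rewrite (star_homM hf) (star_homM hg) fy fz.
- by move=> y fy; rewrite (star_hom_star hf) (star_hom_star hg) fy.
apply: closed_normP => y clos /=; apply/eqP; rewrite -subr_eq0 -normr_le0.
apply/ler_addgt0Pr => e e0; rewrite add0r.
have [|z /= fz yz] := clos (e / 2); first by rewrite divr_gt0.
have -> : f y - g y = f (y - z) - g (y - z).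
  by rewrite (star_homB hf) (star_homB hg) fz opprB addrA subrK.
rewrite (le_trans (ler_normB _ _))// [e]splitr lerD//.
  by rewrite (le_trans (star_hom_contractive hf _))// ltW.
by rewrite (le_trans (star_hom_contractive hg _))// ltW.
Qed.

(** Contractivity of each [b l] keeps the image section within the same bound. *)
Lemma star_hom_dsum (L : Type) (B C : L -> cstarAlgType R)
    (b : forall l, B l -> C l) : (forall l, star_hom (b l)) ->
  exists2 F : cstar_dsum B -> cstar_dsum C,
    star_hom F & forall f l, F f l = b l (f l).
Proof.
move=> hb.
have bounded (f : cstar_dsum B) : exists M : R, forall l, `|b l (f l)| <= M%:C.
  have [M fM] := dsum_bounded f; exists M => l.
  by rewrite (le_trans (star_hom_contractive (hb l) _)).
exists (fun f => CStarDSum (bounded f)) => //; split; first split.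
- by move=> k f g; apply: dsumP => l /=; rewrite star_hom_lin.
- by move=> f g; apply: dsumP => l /=; rewrite star_homM.
- by move=> f; apply: dsumP => l /=; rewrite star_hom_star.
Qed.

(** The identification of [B] with the C*-algebra carrying [N] is a bijective *-homomorphism; it and
    its inverse are both contractive, so it is isometric. *)
Lemma cstar_mxnorm1 B (N : 'M[B]_1 -> R[i]) (b : B) :
  cstar_mxnorm N -> N (const_mx b) = `|b|.
Proof.
move=> [M [phi [phiB phiL phiM phiS NE]]].
pose f (b : B) := phi (const_mx b).
have hf : star_hom f.
  split; first split.
  - by move=> k x y; rewrite /f -phiL; congr phi; apply/matrixP => i j; rewrite !mxE.
  - move=> x y; rewrite /f -phiM; congr phi; apply/matrixP => i j.
    by rewrite !mxE big_ord1 !mxE.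
  - by move=> x; rewrite /f -phiS; congr phi; apply/matrixP => i j; rewrite !mxE.
have cE (x : 'M[B]_1) : const_mx (x ord0 ord0) = x.
  by apply/matrixP => i j; rewrite !mxE !ord1.
have fI : injective f.
  by move=> x y /(bij_inj phiB)/matrixP/(_ ord0 ord0); rewrite !mxE.
have [|g hg fg] := star_hom_lift hf fI (star_hom_id M).
  move=> y _; have [psi _ phiK] := phiB.
  by exists (psi y ord0 ord0) => //; rewrite /f cE phiK.
rewrite NE; apply/eqP; rewrite eq_le (star_hom_contractive hf)/=.
have gf : g (f b) = b by apply: fI; rewrite fg.
by have := star_hom_contractive hg (f b); rewrite gf.
Qed.

End StarHomConstructions.

(** * C*-covers and their morphisms *)

Section Covers.
Context (R : realType) (A : opAlgType R).
Implicit Types c d m : cstar_cover A.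

(** A cover is only required to preserve matrix norms. A representation of [A] preserves these and
    the norm of [A], and so ties the norm to the matrix norm of size 1. *)
Lemma normr_cover_map c a : `|cover_map c a| = `|a|.
Proof.
have [B [f [_ fN fI]]] := @opalg_representable R A.
have [N1 N1P N1E] := fI 1%N; have [N2 N2P N2E] := cover_map_isometric c 1.
have := N2E (const_mx a); rewrite N1E !map_const_mx.
by rewrite !cstar_mxnorm1// fN.
Qed.

Lemma cover_map_lin c (k : R[i]) (a b : A) :
  cover_map c (k *: a + b) = k *: cover_map c a + cover_map c b.
Proof. by have [h _] := cover_map_hom c; apply: h. Qed.

Lemma cover_mapB c (a b : A) :
  cover_map c (a - b) = cover_map c a - cover_map c b.
Proof. by rewrite -scaleN1r addrC cover_map_lin scaleN1r addrC. Qed.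

Lemma cover_hom_eq c (C : cstarAlgType R) (f g : c -> C) :
  star_hom f -> star_hom g ->
  (forall a, f (cover_map c a) = g (cover_map c a)) -> f =1 g.
Proof.
move=> hf hg fg; apply: (star_hom_eq_gen hf hg (cover_gen c)) => _ [a _ <-].
exact: fg.
Qed.

Lemma cover_equiv_refl c : cover_equiv c c.
Proof. by exists id => //; split; [exact: star_hom_id|exists id]. Qed.

(** * Admissibility and extremal covers *)

Section Dynamics.
Context (G : topologicalGroupType) (alpha : G -> A -> A).
Hypothesis dyn : dynamical_system alpha.

Definition equivariant_at s c (p : c -> c) : Prop :=
  star_hom p /\ forall a, p (cover_map c a) = cover_map c (alpha s a).

(** Uniqueness of extensions forces the group law on independently chosen extensions. The points
    with continuous orbit map form a closed *-subalgebra containing the image of [A]. *)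
Lemma admissibleP c :
  admissible alpha c <-> forall s, exists p, equivariant_at s (c := c) p.
Proof.
have [_ _ [act1 actM] _ cont] := dyn.
split=> [[beta [_ hbeta _ betaE]] s|]; first by exists (beta s).
move=> /choice[beta /all_and2[hbeta betaE]]; exists beta; split=> //.
- split=> [|s t].
    by apply: (cover_hom_eq (hbeta 1%g) (star_hom_id c)) => a; rewrite betaE act1.
  apply: (cover_hom_eq (hbeta _) (star_hom_comp (hbeta t) (hbeta s))) => a.
  by rewrite /= !betaE actM.
move=> x; have Xx : cstar_gen (range (cover_map c)) x by rewrite cover_gen.
apply: (Xx [set x | continuous (fun s => beta s x)]); split; last first.
  move=> _ [a _ <-] s; apply/cvgrPdist_le => e e0.
  have /cvgrPdist_le/(_ e e0) := cont a s; apply: filterS => t.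
  by rewrite !betaE -cover_mapB normr_cover_map.
split; first split=> /=.
- by under eq_fun do rewrite (star_hom0 (hbeta _)); exact: cst_continuous.
- move=> k y z yc zc s; under eq_fun do rewrite (star_hom_lin (hbeta _)).
  by apply: cvgD; [apply: cvgZl_tmp; exact: yc|exact: zc].
- move=> y z yc zc s; under eq_fun do rewrite (star_homM (hbeta _)).
  by apply: cvg_amul; [exact: yc|exact: zc].
- move=> y yc s; under eq_fun do rewrite (star_hom_star (hbeta _)).
  by apply: cvg_star; exact: yc.
apply: closed_normP => y clos s; apply/cvgrPdist_le => e e0.
have e30 : 0 < e / 3 by rewrite divr_gt0.
have [z zc yz] := clos _ e30.
(* This bound is uniform in [t], which lets continuity at [z] carry over to [y]. *)
have le3 t : `|beta t (y - z)| <= e / 3.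
  by rewrite (le_trans (star_hom_contractive (hbeta t) _))// ltW.
have /cvgrPdist_le/(_ _ e30) := zc s; apply: filterS => t zt.
have -> : beta s y - beta t y =
    beta s (y - z) + (beta s z - beta t z) - beta t (y - z).
  by rewrite !(star_homB (hbeta _)) opprB subrKA subrKA.
have -> : e = e / 3 + e / 3 + e / 3.
  by rewrite -!mulrDl -mulr2n -mulrSr -[e *+ _]mulr_natr mulfK// pnatr_eq0.
rewrite (le_trans (ler_normB _ _))// lerD//.
by rewrite (le_trans (ler_normD _ _))// lerD.
Qed.

(** Each extension [b] on [d] is conjugated to [p^-1 b p] on [c]. *)
Lemma admissible_equiv c d :
  cover_equiv d c -> admissible alpha d -> admissible alpha c.
Proof.
move=> [p [hp pB] pE] /admissibleP ad; apply/admissibleP => s.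
have [b [hb bE]] := ad s; have pI := bij_inj pB.
have [x _|g hg gE] := star_hom_lift hp pI (star_hom_comp hp hb).
  by have [q _ qK] := pB; exists (q x).
by exists g; split=> // a; apply: pI; rewrite gE /= !pE bE.
Qed.

Section Twist.
Variables (c : cstar_cover A) (s : G).

Let twist_map (a : A) : c := cover_map c (alpha s a).

Let twist_hom : alg_hom twist_map.
Proof.
have [_ _ _ /(_ s)[[al aM] _] _] := dyn; have [cl cM] := cover_map_hom c.
by split=> [k x y|x y]; rewrite /twist_map ?al ?aM ?cl ?cM.
Qed.

Let twist_isometric : mx_isometric (@mxnorm R A) twist_map.
Proof.
have [_ _ _ /(_ s)[_ aI] _] := dyn.
move=> n; have [N NP NE] := cover_map_isometric c n; exists N => // a.
by rewrite -aI NE -map_mx_comp.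
Qed.

Let twist_gen : cstar_gen (range twist_map) = setT.
Proof.
have [_ _ [act1 actM] _ _] := dyn.
rewrite -(cover_gen c); congr cstar_gen; apply/seteqP; split=> _ [a _ <-].
  by exists (alpha s a).
by exists (alpha s^-1%g a); rewrite // /twist_map -actM mulgV act1.
Qed.

(** Same C*-algebra, with the embedding precomposed with [alpha s]. A morphism of covers from [c] to
    this twist is exactly a *-endomorphism of [c] extending [alpha s]. *)
Definition cover_twist : cstar_cover A :=
  CStarCover twist_hom twist_isometric twist_gen.

End Twist.

(** This serves the join of the empty family. Minimality gives a morphism out of the twist, so
    twisting by [s^-1] makes it extend [alpha s]. *)
Lemma envelope_admissible c : is_cstar_envelope c -> admissible alpha c.
Proof.
have [_ _ [act1 actM] _ _] := dyn.
move=> env; apply/admissibleP => s.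
have [p hp pE] := env (cover_twist c s^-1%g).
by exists p; split=> // a; rewrite -[in RHS](pE (alpha s a)) /= -actM mulVg act1.
Qed.

Lemma maximal_admissible c : is_maximal_cover c -> admissible alpha c.
Proof.
move=> cmax; apply/admissibleP => s.
by have [p hp pE] := cmax (cover_twist c s); exists p.
Qed.

(** * Joins and meets of admissible covers *)

Lemma join_admissible (L : Type) (c : L -> cstar_cover A) d :
  (forall l, admissible alpha (c l)) -> is_cover_join c d -> admissible alpha d.
Proof.
move=> cadm [djoin dempty].
have [L0|/dempty] := pselect (inhabited L); last exact: envelope_admissible.
have [J [phi [JE hphi phiI phiT phiE]]] := djoin L0.
apply/admissibleP => s.
pose b l := projT1 (cid ((admissibleP (c l)).1 (cadm l) s)).
have bP l : equivariant_at s (b l) by rewrite /b; case: cid.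
have [F hF FE] := star_hom_dsum (fun l => (bP l).1).
have FJ a : F (J a) = J (alpha s a).
  by apply: dsumP => l; rewrite FE !JE (bP l).2.
(* [F] maps [range J] into itself, hence also the C*-algebra it generates, which is the copy of [d]
   in the direct sum. *)
have [|g hg gE] := star_hom_lift hphi phiI (star_hom_comp hphi hF).
  move=> _ [x _ <-]; rewrite phiT; apply: (star_hom_cstar_gen (X := range J)) => //.
    by move=> _ [a _ <-]; exists (alpha s a).
  by rewrite -phiT; exists x.
by exists g; split=> // a; apply: phiI; rewrite gE /= !phiE FJ.
Qed.

Lemma meet_admissible (L : Type) (c : L -> cstar_cover A) d :
  (forall l, admissible alpha (c l)) -> is_cover_meet c d -> admissible alpha d.
Proof.
move=> cadm [m [q [phi [mmax qP [hphi phiE] phiT kphi]]]].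
apply/admissibleP => s.
have [t [ht tE]] := (admissibleP m).1 (maximal_admissible mmax) s.
(* [q l] intertwines [t] with the extension [b] on [c l], as both composites agree on the image of
   [A]. *)
have tq l x : q l x = 0 -> q l (t x) = 0.
  move=> qx; have [b [hb bE]] := (admissibleP (c l)).1 (cadm l) s.
  have [hq qE] := qP l.
  have qt := cover_hom_eq (star_hom_comp ht hq) (star_hom_comp hq hb).
  have /= -> := qt _ x; first by rewrite qx (star_hom0 hb).
  by move=> a /=; rewrite tE !qE bE.
have tker x : sum_ker q x -> sum_ker q (t x).
  move=> [n [l [y [qy ->]]]]; exists n, l, (t \o y); split=> [i|].
    by apply: tq.
  by rewrite (big_morph t (star_homD ht) (star_hom0 ht)).
(* Contractivity of [t] carries invariance from the sum of kernels to its closure, the kernel of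
   [phi]. *)
have [|p hp pE] := star_hom_factor hphi phiT (star_hom_comp ht hphi).
  have kphiE x : phi x = 0 <-> closure (sum_ker q) x by rewrite -kphi.
  move=> x /kphiE/closure_normP xk; apply/kphiE/closure_normP => e /xk[y ky xy].
  exists (t y); first exact: tker.
  by rewrite -(star_homB ht) (le_lt_trans (star_hom_contractive ht _)).
by exists p; split=> // a; rewrite -phiE pE /= tE phiE.
Qed.

End Dynamics.
End Covers.

Theorem theorem3p13 (R : realType) (A : opAlgType R) (G : topologicalGroupType)
    (alpha : G -> A -> A) (dyn : dynamical_system alpha) :
  complete_sublattice (CLat_admissible alpha).
Proof.
split=> [x [c _ ->]|L x xadm]; first by exists c.
(* The representatives used by a join or meet are arbitrary, whereas membership of [x l] only
   provides some admissible one; equivalence transfers admissibility between them. *)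
have adm (c : L -> cstar_cover A) :
    (forall l, x l = cover_class (c l)) -> forall l, admissible alpha (c l).
  move=> xE l; have [d dadm xd] := xadm l.
  apply: (admissible_equiv dyn _ dadm).
  by rewrite -[cover_equiv d]/(cover_class d) -xd xE; exact: cover_equiv_refl.
split=> y [c [d [xE -> cd]]]; exists d => //.
  exact: (join_admissible dyn (adm c xE) cd).
exact: (meet_admissible dyn (adm c xE) cd).
Qed.
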